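(* Let $\Omega\subseteq\mathbb{R}$ be an open interval, let $\alpha,\beta>0$ and $f\in \mathrm{L}^{2}(\Omega)$. Let $(u,w)\in \mathrm{BV}(\Omega)\times \mathrm{L}^{\infty}(\Omega)$ be a solution of the minimisation problem \[\min_{u\in\mathrm{BV}(\Omega),\; w\in \mathrm{L}^{\infty}(\Omega)}\ \frac{1}{2}\|f-u\|_{\mathrm{L}^{2}(\Omega)}^{2}+\alpha \|Du-w\|_{\mathcal{M}}+\beta \|w\|_{\mathrm{L}^{\infty}(\Omega)},\] and let $\phi\in \mathrm{H}_{0}^{1}(\Omega)$ be the corresponding dual function, i.e. the function satisfying the optimality conditions recalled in the context. Then $|w|=\|w\|_{\mathrm{L}^{\infty}(\Omega)}$ almost everywhere in the set $\{\phi\neq 0\}$. Moreover, $|u'|=\|w\|_{\mathrm{L}^{\infty}(\Omega)}$ almost everywhere in the set $\{u>f\}\cup\{u<f\}$, where $u'$ denotes the density of the absolutely continuous part of $Du$ with respect to Lebesgue measure.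
   Context: $Du$ denotes the distributional derivative of $u\in\mathrm{BV}(\Omega)$, a finite Radon measure on $\Omega$; $w\in\mathrm{L}^\infty(\Omega)$ is identified with the measure $w\,dx$; and $\|\mu\|_{\mathcal{M}}$ denotes the Radon norm (total variation) of a measure $\mu$, $\|\mu\|_{\mathcal M}=\sup\{\int_\Omega \psi\,d\mu:\ \psi\in C_c^\infty(\Omega),\ \|\psi\|_\infty\le 1\}$. For a finite Radon measure $\mu$ on $\Omega$, \[\mathrm{Sgn}(\mu)=\Big\{\phi\in \mathrm{L}^{\infty}(\Omega)\cap \mathrm{L}^{\infty}(\Omega,\mu):\ \|\phi\|_{\mathrm{L}^{\infty}(\Omega)}\le 1,\ \phi=\tfrac{d\mu}{d|\mu|}\ \ |\mu|\text{-a.e.}\Big\}.\] Optimality conditions: a pair $(u,w)\in\mathrm{BV}(\Omega)\times\mathrm{L}^\infty(\Omega)$ solves the minimisation problem in the claim if and only if there exists a unique $\phi\in\mathrm{H}^1_0(\Omega)$ (identified with its continuous representative), called the corresponding dual function, such that (1) $\phi'=u-f$; (2) $\phi\in\alpha\,\mathrm{Sgn}(Du-w)$; (3) $\|\phi\|_{\mathrm{L}^1(\Omega)}\le\beta$, and, if $w\neq0$, additionally $\int_\Omega \phi\, w\,dx=\beta\|w\|_{\mathrm{L}^\infty(\Omega)}$. *)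

(* Defs.v *)
From HB Require Import structures.
From mathcomp Require Import all_boot all_order all_algebra.
From mathcomp Require Import all_classical all_reals all_analysis.

Set Implicit Arguments.
Unset Strict Implicit.
Unset Printing Implicit Defensive.
Import Order.TTheory GRing.Theory Num.Theory.
Import numFieldNormedType.Exports.

Local Open Scope classical_set_scope.
Local Open Scope ring_scope.
Local Open Scope charge_scope.

(* Elements of L^p(Omega), BV(Omega), H^1_0(Omega) are given by Borel
   representatives R -> R whose values outside Omega are irrelevant: all norms
   are those of the extension by zero f \_ Omega. *)

Notation leb := (@lebesgue_measure _).

(* A finite Radon measure on Omega is a charge on the Borel sets of R that
   vanishes outside Omega (see [carried_by]). *)
Notation radon R := ({charge set (measurableTypeR R) -> \bar R}%R).

Definition open_interval {R : realType} (Omega : set R) : Prop :=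
  [/\ is_interval Omega, open Omega & Omega !=set0].

Definition LpNorm {R : realType} (Omega : set R) (p : \bar R) (f : R -> R) :
    \bar R :=
  ('N[leb]_p [EFin \o (f \_ Omega)])%E.

Definition Lp {R : realType} (Omega : set R) (p : \bar R) (f : R -> R) : Prop :=
  f \_ Omega \in Lfun (@lebesgue_measure R) p.

Definition test_function {R : realType} (Omega : set R) (psi : R -> R) : Prop :=
  [/\ forall n x, derivable (psi^`(n))%classic x 1,
      compact (closure [set x | psi x != 0]) &
      closure [set x | psi x != 0] `<=` Omega].

Definition carried_by {R : realType} (Omega : set R) (mu : radon R) : Prop :=
  forall A : set (measurableTypeR R),
    measurable A -> A `&` Omega = set0 -> mu A = 0%E.

Definition hahn_pos {R : realType} (mu : radon R) :=
  sval (cid (Hahn_decomposition mu)).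

Definition hahn_neg {R : realType} (mu : radon R) :=
  sval (cid (svalP (cid (Hahn_decomposition mu)))).

Definition hahnP {R : realType} (mu : radon R) :
    hahn_decomposition mu (hahn_pos mu) (hahn_neg mu) :=
  svalP (cid (svalP (cid (Hahn_decomposition mu)))).

Definition abs_charge {R : realType} (mu : radon R) :
    set (measurableTypeR R) -> \bar R :=
  charge_variation (hahnP mu).

Section abs_charge_measure.
Context {R : realType} (mu : radon R).
HB.instance Definition _ := Measure.on (abs_charge mu).
Let abs_charge_finite : fin_num_fun (abs_charge mu).
Proof. by move=> A mA; rewrite /abs_charge; exact: fin_num_measure. Qed.
HB.instance Definition _ :=
  @Measure_isFinite.Build _ _ _ (abs_charge mu) abs_charge_finite.
End abs_charge_measure.

Definition charge_integral {R : realType} (mu : radon R) (psi : R -> R) : R :=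
  \int[jordan_pos (hahnP mu)]_x psi x - \int[jordan_neg (hahnP mu)]_x psi x.

(* The Radon norm of the measure on Omega that acts on test functions by I.
   Stating it through the action also covers signed measures on an unbounded
   Omega that are only locally finite; their norm is +oo. *)
Definition radon_norm {R : realType} (Omega : set R) (I : (R -> R) -> R) :
    \bar R :=
  ereal_sup [set (I psi)%:E | psi in
    [set psi | test_function Omega psi /\ forall x, `|psi x| <= 1]].

(* The action psi |-> \int psi d(mu - w dx). *)
Definition sub_density_action {R : realType} (Omega : set R) (mu : radon R)
    (w : R -> R) (psi : R -> R) : R :=
  charge_integral mu psi - \int[leb]_(x in Omega) (psi x * w x).

(* mu - w dx as a finite signed measure, for w in L^1(Omega). *)
Definition sub_density {R : realType} (Omega : set R) (mu : radon R)
    (w : R -> R)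
    (hw : (@lebesgue_measure R).-integrable setT (EFin \o (w \_ Omega))) :
    radon R :=
  cadd mu (copp (induced_charge hw)).

Definition Sgn {R : realType} (Omega : set R) (mu : radon R) :
    set (R -> R) :=
  [set phi | [/\ Lp Omega +oo%E phi,
                 phi \_ Omega \in Lfun (abs_charge mu) +oo%E,
                 (LpNorm Omega +oo phi <= 1)%E &
                 {ae abs_charge mu, forall x, Omega x ->
                    (phi x)%:E = ('d mu '/d (abs_charge mu)) x}]].

Definition singular {R : realType} (mu : radon R) : Prop :=
  exists N : set (measurableTypeR R),
    [/\ measurable N, @lebesgue_measure R N = 0%E &
        forall A : set (measurableTypeR R),
          measurable A -> A `&` N = set0 -> mu A = 0%E].

(* g is the density in the Lebesgue decomposition mu = g dx + mus on Omega. *)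
Definition ac_density {R : realType} (Omega : set R) (mu : radon R)
    (g : R -> R) : Prop :=
  (@lebesgue_measure R).-integrable Omega (EFin \o g) /\
  exists2 mus : radon R, singular mus &
    forall A : set (measurableTypeR R), measurable A -> A `<=` Omega ->
      (mu A = \int[leb]_(x in A) (g x)%:E + mus A)%E.

Definition is_distributional_derivative {R : realType} (Omega : set R)
    (u : R -> R) (mu : radon R) : Prop :=
  carried_by Omega mu /\
  forall psi, test_function Omega psi ->
    \int[leb]_(x in Omega) (u x * (psi^`())%classic x) = - charge_integral mu psi.

Definition BV {R : realType} (Omega : set R) (u : R -> R) : Prop :=
  Lp Omega 1 u /\ exists mu, is_distributional_derivative Omega u mu.

(* Du, which is determined by u up to its values on non-measurable sets; the
   default value is only taken when u is not in BV(Omega). *)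
Definition distributional_derivative {R : realType} (Omega : set R)
    (u : R -> R) : radon R :=
  match pselect (exists mu, is_distributional_derivative Omega u mu) with
  | left Du => sval (cid Du)
  | right _ => czero
  end.

Definition weak_derivative {R : realType} (Omega : set R) (phi g : R -> R) :
    Prop :=
  forall psi, test_function Omega psi ->
    \int[leb]_(x in Omega) (phi x * (psi^`())%classic x) =
      - \int[leb]_(x in Omega) (g x * psi x).

(* phi is in H^1(Omega) and phi' = g. *)
Definition H1 {R : realType} (Omega : set R) (phi g : R -> R) : Prop :=
  [/\ Lp Omega 2%:E phi, Lp Omega 2%:E g & weak_derivative Omega phi g].

(* phi is in H^1_0(Omega), the closure of the test functions in H^1(Omega),
   and phi' = g. *)
Definition H10 {R : realType} (Omega : set R) (phi g : R -> R) : Prop :=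
  H1 Omega phi g /\
  exists psi : nat -> R -> R,
    [/\ forall n, test_function Omega (psi n),
        LpNorm Omega 2%:E (psi n \- phi) @[n --> \oo] --> 0%E &
        LpNorm Omega 2%:E ((psi n)^`()%classic \- g) @[n --> \oo] --> 0%E].

Definition objective {R : realType} (Omega : set R) (alpha beta : R)
    (f u w : R -> R) : \bar R :=
  ((2^-1)%:E * LpNorm Omega 2%:E (f \- u)%R ^+ 2
   + alpha%:E * radon_norm Omega
       (sub_density_action Omega (distributional_derivative Omega u) w)
   + beta%:E * LpNorm Omega +oo w)%E.

Definition is_solution {R : realType} (Omega : set R) (alpha beta : R)
    (f u w : R -> R) : Prop :=
  [/\ BV Omega u, Lp Omega +oo%E w &
      forall v z, BV Omega v -> Lp Omega +oo%E z ->
        (objective Omega alpha beta f u w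
           <= objective Omega alpha beta f v z)%E].

(* The optimality conditions on phi in H^1_0(Omega). The second one presupposes
   that Du - w is a finite measure, i.e. that w is in L^1(Omega); this is
   automatic for bounded Omega. *)
Definition dual_function {R : realType} (Omega : set R) (alpha beta : R)
    (f u w phi : R -> R) : Prop :=
  [/\ forall x, Omega x -> {for x, continuous phi},
      H10 Omega phi (u \- f),
      exists hw : (@lebesgue_measure R).-integrable setT
                    (EFin \o (w \_ Omega)),
        [set (fun x => alpha * psi x) | psi in
           Sgn Omega (sub_density (distributional_derivative Omega u) hw)] phi &
      (LpNorm Omega 1 phi <= beta%:E)%E /\
      (~ {ae leb, forall x, Omega x -> w x = 0} ->
       (\int[leb]_(x in Omega) (phi x * w x)%:E
          = beta%:E * LpNorm Omega +oo w)%E)].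

(* Main.v *)
Require Import Defs.
From mathcomp Require Import all_boot all_order all_algebra.
From mathcomp Require Import all_classical all_reals all_analysis.
From mathcomp Require Import measurable_realfun ess_sup_inf ring.
Import Order.TTheory GRing.Theory Num.Theory.
Import numFieldNormedType.Exports.
Local Open Scope classical_set_scope.
Local Open Scope ring_scope.

(* Since the L^1 norm of phi is at most beta and \int phi w = beta M with
   M = ||w||_oo, the function M |phi| - phi w >= 0 has a nonpositive integral,
   hence vanishes a.e., which gives |w| = M where phi <> 0.
   The condition phi \in alpha Sgn(Du - w) forces |phi| = alpha a.e. for
   |Du - w|, so Du and w dx agree as measures on {|phi| <> alpha} and thus
   u' = w a.e. there. Finally phi is an indefinite integral of u - f, so
   u = f a.e. on each of the level sets {phi = 0}, {phi = alpha} and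
   {phi = - alpha}: a point of a level set where phi has a nonzero derivative
   is isolated in it, and there are countably many such points. *)

(* The instances of the library are not found when almost_everywhere is
   elaborated over the type R itself. *)
#[local] Instance ae_leb_filter (R : realType) :
  Filter (nbhs (almost_everywhere (@lebesgue_measure R))).
Proof.
exact: (@ae_filter_ringOfSetsType _ (measurableTypeR R) _
  (@lebesgue_measure R)).
Qed.

(** * Level sets at points of nonzero derivative *)

Lemma countable_level_derive_neq0 {R : realType} (G : R -> R) (k : R) :
  countable [set x | [/\ G x = k, derivable G x 1 & (G^`())%classic x != 0]].
Proof.
(* Each [S pq] has at most one point, the only point of the level set in a rational interval.
   Isolated points of the level set lie in some [S pq], and the pairs [pq] are countably many. *)
pose S (pq : rat * rat) := [set x : R | [/\ ratr pq.1 < x < ratr pq.2, G x = k &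
  forall y, ratr pq.1 < y < ratr pq.2 -> G y = k -> y = x]].
apply: (@sub_countable _ _ _ (\bigcup_(pq in [set: rat * rat]) S pq));
  last first.
  apply: bigcup_countable => //.
  move=> pq _; have [->|/set0P[x Sx]] := eqVneq (S pq) set0;
    first exact: countable0.
  apply: (@sub_countable _ _ _ [set x]); last exact: countable1.
  apply: subset_card_le => y [y1 y2 y3] /=.
  by case: Sx => x1 x2 x3; exact: x3.
apply: subset_card_le => x [Gxk dG G'x].
(* The difference quotients tend to a nonzero limit, so they do not vanish near 0: within some
   distance [e], [x] is alone on its level. *)
have : \forall h \near 0^', h^-1 *: (G (h + x) - G x) != 0.
  have /cvgr_neq0 : h^-1 *: (G (h + x) - G x) @[h --> 0^'] -->
      (G^`())%classic x.
    have /cvg_ex[l Hl] := dG.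
    have E : (fun h => h^-1 *: ((G \o shift x) (h *: 1) - G x)) =
             (fun h => h^-1 *: (G (h + x) - G x)).
      by apply/funext => h /=; rewrite [h *: 1]mulr1.
    rewrite E in Hl.
    by rewrite derive1E /derive E; rewrite (cvg_lim _ Hl).
  exact.
rewrite near_withinE => -[e /= e0 He].
have [p pP] : exists p : rat, x - e < ratr p < x.
  have /rat_in_itvoo[p] : x - e < x by rewrite ltrBlDr ltrDl.
  by rewrite in_itv /=; exists p.
have [q qP] : exists q : rat, x < ratr q < x + e.
  have /rat_in_itvoo[q] : x < x + e by rewrite ltrDl.
  by rewrite in_itv /=; exists q.
case/andP: pP => p1 p2; case/andP: qP => q1 q2.
exists (p, q) => //; split => //=; first by rewrite p2 q1.
move=> y /andP[py yq] Gyk; apply: contrapT => /eqP yx.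
have := He (y - x); rewrite /= sub0r normrN subrK Gyk Gxk subrr scaler0 eqxx.
rewrite subr_eq0 => /(_ _ yx) /negP; apply => //.
by rewrite ltr_distl (lt_trans p1 py) (lt_trans yq q2).
Qed.

(** * Density of a signed measure with respect to its variation *)

Section abs_charge_density.
Local Open Scope charge_scope.
Context {R : realType} (mu : radon R).

Lemma abs_charge_dominates : mu `<< abs_charge mu.
Proof. by apply/(null_charge_dominatesP (hahnP mu)). Qed.

Lemma abs_charge_pos (A : set (measurableTypeR R)) :
  measurable A -> A `<=` hahn_pos mu -> (abs_charge mu A = mu A)%E.
Proof.
move=> mA AP; have [_ _ _ PN0] := hahnP mu.
rewrite /abs_charge /charge_variation/= jordan_posE cjordan_posE.
rewrite jordan_negE cjordan_negE /crestr0 !mem_set// /crestr.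
rewrite (setIidl AP) (_ : A `&` _ = set0) ?charge0 ?oppe0 ?adde0//.
by rewrite -subset0 -PN0; exact: setSI.
Qed.

Lemma abs_charge_neg (A : set (measurableTypeR R)) :
  measurable A -> A `<=` hahn_neg mu -> (abs_charge mu A = - mu A)%E.
Proof.
move=> mA AN; have [_ _ _ PN0] := hahnP mu.
rewrite /abs_charge /charge_variation/= jordan_posE cjordan_posE.
rewrite jordan_negE cjordan_negE /crestr0 !mem_set// /crestr.
rewrite (setIidl AN) (_ : A `&` _ = set0) ?charge0 ?add0e//.
by rewrite -subset0 -PN0 setIC; exact: setIS.
Qed.

(** On each Hahn set the density has the same integrals over measurable subsets as the constant 1 or
    -1, hence agrees with it a.e.; the two Hahn sets cover the line. *)
Lemma abs_charge_density_norm1 :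
  {ae abs_charge mu, forall x, (`|('d mu '/d (abs_charge mu)) x| = 1)%E}.
Proof.
have [[mP _] [mN _] PN _] := hahnP mu.
have dens := Radon_Nikodym_integrable abs_charge_dominates.
have intE (A : set (measurableTypeR R)) : measurable A ->
    (\int[abs_charge mu]_(x in A) ('d mu '/d (abs_charge mu)) x = mu A)%E.
  by move=> mA; rewrite -Radon_Nikodym_integral//; exact: abs_charge_dominates.
have aeP : ae_eq (abs_charge mu) (hahn_pos mu) ('d mu '/d (abs_charge mu))
    (cst 1%E).
  apply: integral_ae_eq => //; first exact: integrableS dens.
  by move=> A AP mA; rewrite intE// integral_cst// mul1e;
    exact/esym/abs_charge_pos.
have aeN : ae_eq (abs_charge mu) (hahn_neg mu) ('d mu '/d (abs_charge mu))
    (cst (- 1)%E).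
  apply: integral_ae_eq => //; first exact: integrableS dens.
  move=> A AN mA; rewrite intE// integral_cst//.
  have E := abs_charge_neg _ mA AN.
  by transitivity (- abs_charge mu A)%E; [rewrite E oppeK|rewrite mulN1e].
apply: filterS2 aeP aeN => x hP hN.
have : (hahn_pos mu `|` hahn_neg mu) x by rewrite PN.
by case=> [/hP ->|/hN ->]; rewrite ?abseN ?abse1.
Qed.

(** On [Omega], [psi] is a.e. the density, which a.e. has modulus 1, both for the variation of [mu].
    So [A] lies in the union of two null sets of the variation, and the variation bounds |mu A|. *)
Lemma Sgn_null (Omega : set R) (psi : R -> R) (A : set (measurableTypeR R)) :
  Sgn Omega mu psi -> measurable A -> A `<=` Omega ->
  (forall x, A x -> `|psi x| != 1) -> mu A = 0%E.
Proof.
move=> [_ _ _ psiE] mA AO Apsi.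
have [N1 [mN1 N10 sub1]] := psiE.
have [N2 [mN2 N20 sub2]] := abs_charge_density_norm1.
have AN : A `<=` N1 `|` N2.
  move=> x Ax; apply: contrapT => /not_orP[].
  move=> /(contra_not (sub1 x)) /contrapT psix.
  move=> /(contra_not (sub2 x)) /contrapT /= h1.
  have /eqP := Apsi _ Ax; apply.
  by move: h1; rewrite -psix; [case|exact: AO].
have A0 : abs_charge mu A = 0%E.
  apply: (subset_measure0 _ _ AN) => //; first exact: measurableU.
  exact: (null_set_setU (mu := abs_charge mu) mN1 mN2 N10 N20).
have : (`|mu A| <= abs_charge mu A)%E by exact: abse_charge_variation.
by rewrite A0 => muA; apply/eqP; rewrite -abse_eq0 eq_le muA abse_ge0.
Qed.

End abs_charge_density.

(** * Functions in H^1_0 are locally indefinite integrals *)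

(** The constant is the mean [C] of [D] over [B]: if [D] is e/2-close to [c] in L^1, averaging gives
    |C - c| mu(B) <= e/2, so [D] is e-close to [C], for every e > 0. *)
Lemma ae_cst_of_L1_approx {d} {T : measurableType d} {R : realType}
    (mu : {measure set T -> \bar R}) (B : set T) (D : T -> R) :
  measurable B -> (0 < mu B < +oo)%E -> mu.-integrable B (EFin \o D) ->
  (forall e, 0 < e -> exists c, \int[mu]_(x in B) `|D x - c| <= e) ->
  exists C, {ae mu, forall x, B x -> D x = C}.
Proof.
move=> mB /andP[B0 Boo] iD DL1.
have fB : mu B \is a fin_num by rewrite ge0_fin_numE.
have icst c : mu.-integrable B (EFin \o cst c).
  apply/integrableP; split=> /=; first exact/measurable_EFinP/measurable_cst.
  by rewrite (integral_cst mu mB) lte_mul_pinfty.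
have iB c : mu.-integrable B (EFin \o (fun x => D x - c)).
  exact: (integrableB mB iD (icst c)).
have iBn c : mu.-integrable B (EFin \o (fun x => `|D x - c|)).
  exact: (integrable_norm (iB c)).
have m0 : 0 < fine (mu B) by rewrite fine_gt0 ?B0.
pose C := (\int[mu]_(x in B) D x) / fine (mu B).
exists C.
have int0 : \int[mu]_(x in B) `|D x - C| = 0.
  apply/eqP; rewrite eq_le Rintegral_ge0 ?andbT//.
  apply/ler_addgt0Pr => e e0; rewrite add0r.
  have [c Dc] := DL1 (e / 2) (divr_gt0 e0 (ltr0Sn _ 1)).
  have Cc : `|C - c| * fine (mu B) <= e / 2.
    apply: le_trans Dc; apply: le_trans (le_normr_Rintegral mB (iB c)).
    rewrite (RintegralB mB iD (icst c)) Rintegral_cst//.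
    rewrite -[X in _ * X](gtr0_norm m0) -normrM.
    by rewrite mulrBl /C divfK ?gt_eqF.
  apply: (@le_trans _ _ (\int[mu]_(x in B) (`|D x - c| + `|C - c|))).
    apply: le_Rintegral => //.
      exact: (integrableD mB (iBn c) (icst _)).
    move=> x _; rewrite [`|C - c|]distrC; apply: le_trans (ler_normD _ _).
    by rewrite subrKA.
  rewrite (RintegralD mB (iBn c) (icst _)) Rintegral_cst// [leRHS](splitr e).
  exact: lerD.
have : (\int[mu]_(x in B) `|(EFin \o (fun x => D x - C)%R) x| = 0)%E.
  have := integrable_fin_num mB (iBn C); move: int0.
  by rewrite /Rintegral => + H; rewrite -[X in _ -> X = _](fineK H) => ->.
move/ae_eq_integral_abs => /(_ mB (measurable_int _ (iB C))).
by apply: filterS => x /= h /h[] /eqP; rewrite subr_eq0 => /eqP.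
Qed.

Section Lp2.
Context {R : realType} (Omega : set R).

Lemma Lnorm2_indic_fin (a b : R) :
  ('N[leb]_2%:E[EFin \o \1_(`[a, b])] < +oo :> \bar R)%E.
Proof.
rewrite unlock poweR_lty//.
rewrite (_ : (\int[_]_x _)%E = (\int[leb]_x (\1_(`[a, b]%classic) x)%:E)%E);
  last first.
  apply: eq_integral => x _ /=; rewrite indicE.
  by case: (_ \in _); rewrite /= ?normr1 ?normr0 ?powR1 ?powR0.
rewrite integral_indic// setIT.
rewrite /= lebesgue_measure_itv /=; case: ifP => // _; exact: ltry.
Qed.

(** Cauchy-Schwarz against the indicator of [B]. *)
Lemma integral_norm_le_LpNorm2 (h : R -> R) (B : set R) :
  measurable B -> B `<=` Omega -> measurable_fun setT (h \_ Omega) ->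
  (\int[leb]_(x in B) (`|h x|)%:E
     <= LpNorm Omega 2%:E h * 'N[leb]_2%:E[EFin \o \1_B])%E.
Proof.
move=> mB BO mh.
have H : ('N[leb]_1[EFin \o (h \_ Omega \* \1_B)%R]
   <= LpNorm Omega 2%:E h * 'N[leb]_2%:E[EFin \o \1_B])%E.
  by apply: hoelder => //; rewrite [RHS]splitr !div1r.
apply: (le_trans _ H).
rewrite Lnorm1 [X in (X <= _)%E]integral_mkcond le_eqVlt; apply/orP; left;
  apply/eqP.
apply: eq_integral => x _ /=; rewrite patchE indicE.
case: ifPn => xB; last by rewrite mulr0 normr0.
by rewrite mulr1 patchE mem_set//; apply: BO; exact/set_mem.
Qed.

End Lp2.

Section test_function.
Context {R : realType} (Omega : set R) (psi : R -> R).
Hypothesis tpsi : test_function Omega psi.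

Lemma test_function_continuous : continuous psi.
Proof.
by case: tpsi => /(_ 0%N) d _ _ x;
  exact/differentiable_continuous/derivable1_diffP.
Qed.

Lemma test_function_derivable x : derivable psi x 1.
Proof. by case: tpsi => /(_ 0%N). Qed.

Lemma test_function_derive_continuous : continuous (psi^`())%classic.
Proof.
by case: tpsi => /(_ 1%N) d _ _ x;
  exact/differentiable_continuous/derivable1_diffP.
Qed.

Lemma test_function_FTC (a x : R) : a <= x ->
  \int[leb]_(t in `[a, x]) (psi^`())%classic t = psi x - psi a.
Proof.
rewrite le_eqVlt => /predU1P[<-|ax].
  by rewrite set_itv1 Rintegral_set1 subrr.
rewrite /Rintegral (@continuous_FTC2 _ _ psi)//.
- by apply: continuous_subspaceT; exact: test_function_derive_continuous.
- split.
  + by move=> y _; exact: test_function_derivable.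
  + by apply: cvg_at_right_filter; exact: test_function_continuous.
  + by apply: cvg_at_left_filter; exact: test_function_continuous.
Qed.

End test_function.

Section H10_primitive.
Context {R : realType} (Omega : set R).

Lemma Lp_measurable p (f : R -> R) :
  Lp Omega p f -> measurable_fun setT (f \_ Omega).
Proof. by rewrite /Lp inE => /andP[]; rewrite inE. Qed.

Lemma measurable_fun_patch_sub (h : R -> R) (B : set R) : measurable B ->
  B `<=` Omega -> measurable_fun setT (h \_ Omega) -> measurable_fun B h.
Proof.
move=> mB BO /(@measurable_funTS _ _ _ _ B).
by apply: eq_measurable_fun => x xB; rewrite patchE mem_set//; apply: BO;
  exact/set_mem.
Qed.

(** Passes from the L^2 convergence in the definition of H^1_0 to L^1 convergence on compact
    intervals, where primitives can be compared. *)
Lemma LpNorm_cvg0_integral_itv (h : nat -> R -> R) (a b : R) :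
  `[a, b] `<=` Omega -> (forall n, measurable_fun setT (h n \_ Omega)) ->
  LpNorm Omega 2%:E (h n) @[n --> \oo] --> 0%E ->
  forall e, 0 < e ->
    \forall n \near \oo, (\int[leb]_(x in `[a, b]) (`|h n x|)%:E < e%:E)%E.
Proof.
move=> abO mh h0 e e0.
set K := ('N[leb]_2%:E[EFin \o \1_(`[a, b])] : \bar R)%E.
have fK : K \is a fin_num by rewrite ge0_fin_numE ?Lnorm_ge0//;
  exact: Lnorm2_indic_fin.
have : (LpNorm Omega 2%:E (h n) * K)%E @[n --> \oo] --> (0 * K)%E.
  exact: cvgeZr.
rewrite mul0e => /fine_cvgP[fin0 /cvgr_lt] /(_ _ e0) lt0.
near=> n.
apply: (@le_lt_trans _ _ (LpNorm Omega 2%:E (h n) * K)%E).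
  exact: integral_norm_le_LpNorm2.
have fn : (LpNorm Omega 2%:E (h n) * K)%E \is a fin_num by near: n.
rewrite -[ltLHS]fineK// lte_fin.
by near: n.
Unshelve. all: by end_near. Qed.

Lemma Lp2_integrable_itv (h : R -> R) (a b : R) :
  `[a, b] `<=` Omega -> Lp Omega 2%:E h -> leb.-integrable `[a, b] (EFin \o h).
Proof.
move=> abO hL; apply/integrableP; split.
  apply/measurable_EFinP; apply: measurable_fun_patch_sub => //.
  exact: Lp_measurable hL.
apply: le_lt_trans.
  by apply: (integral_norm_le_LpNorm2 _ _ _ _ abO (Lp_measurable _ _ hL)).
rewrite lte_mul_pinfty ?Lnorm_ge0//; last exact: Lnorm2_indic_fin.
move: hL; rewrite /Lp inE => /andP[_]; rewrite inE /finite_norm => hL.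
by rewrite ge0_fin_numE ?Lnorm_ge0.
Qed.

Lemma continuous_measurable_patch (h : R -> R) :
  measurable Omega -> continuous h -> measurable_fun setT (h \_ Omega).
Proof.
move=> mO ch; apply/(measurable_restrictT _ mO).
by apply: measurable_funTS; exact: continuous_measurable_fun.
Qed.

Lemma patchB (h k : R -> R) : (h \- k) \_ Omega = (h \_ Omega) \- (k \_ Omega).
Proof.
by apply/funext => x /=; rewrite !patchE; case: ifPn => // _; rewrite subrr.
Qed.

Lemma H10_ae_primitive (phi g : R -> R) (a b : R) : measurable Omega ->
  H10 Omega phi g -> a < b -> `[a, b] `<=` Omega ->
  exists C, {ae leb, forall x, `[a, b]%classic x ->
    phi x = C + \int[leb]_(t in `[a, x]) g t}.
Proof.
move=> mO [[phiL gL _] [psi [tpsi psi0 dpsi0]]] ab abO.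
have iphi := Lp2_integrable_itv _ _ _ abO phiL.
have ig := Lp2_integrable_itv _ _ _ abO gL.
pose G x := \int[leb]_(t in `[a, x]) g t.
have iG : leb.-integrable `[a, b] (EFin \o G).
  apply: continuous_compact_integrable; first exact: segment_compact.
  exact: parameterized_integral_continuous (ltW ab) ig.
pose D x := phi x - G x.
have iD : leb.-integrable `[a, b] (EFin \o D).
  exact: (integrableB _ iphi iG).
(* If psi tends to phi and psi' to g, then phi - G is close in L^1 to the
   constant psi a, since psi - psi a is the integral of psi'. *)
suff [C DC] : exists C, {ae leb, forall x, `[a, b]%classic x -> D x = C}.
  exists C; apply: filterS DC => x /= DC xab.
  by rewrite -(DC xab) /D subrK.
have lab : leb `[a, b]%classic = (b - a)%:E.
  by rewrite lebesgue_measure_itv/= lte_fin ab.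
apply: ae_cst_of_L1_approx => //.
  by rewrite /= lab lte_fin subr_gt0 ab ltry.
move=> e e0.
(* Chosen so that e = e' + e' (b - a): the first term bounds the L^1 distance from [psi n] to [phi],
   the second the integral over [a, b] of a pointwise error e'. *)
pose e' := e / (1 + (b - a)).
have ba0 : 0 < 1 + (b - a) by rewrite addr_gt0// subr_gt0.
have e'0 : 0 < e' by rewrite divr_gt0.
near \oo => n.
have H1 : (\int[leb]_(x in `[a, b]) (`|psi n x - phi x|)%:E < e'%:E)%E.
  near: n; apply: (LpNorm_cvg0_integral_itv (fun n => psi n \- phi)) => //.
  move=> n; rewrite patchB; apply: measurable_funB;
    last exact: Lp_measurable phiL.
  by apply: continuous_measurable_patch => //;
    exact: test_function_continuous (tpsi n).
have H2 : (\int[leb]_(x in `[a, b])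
    (`|(psi n)^`()%classic x - g x|)%:E < e'%:E)%E.
  near: n; apply: (LpNorm_cvg0_integral_itv (fun n =>
    (psi n)^`()%classic \- g)) => //.
  move=> n; rewrite patchB; apply: measurable_funB;
    last exact: Lp_measurable gL.
  by apply: continuous_measurable_patch => //;
    exact: test_function_derive_continuous (tpsi n).
exists (psi n a).
have icont (h : R -> R) c d : continuous h ->
    leb.-integrable `[c, d] (EFin \o h).
  move=> ch; apply: continuous_compact_integrable; first exact: segment_compact.
  exact: continuous_subspaceT.
have icst c : leb.-integrable `[a, b] (EFin \o cst c).
  by apply: icont => x; exact: cvg_cst.
have iDc c : leb.-integrable `[a, b] (EFin \o (fun x => D x - c)).
  exact: (integrableB _ iD (icst c)).
have ipsi := icont _ a b (test_function_continuous _ _ (tpsi n)).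
have idpsi := icont _ a b (test_function_derive_continuous _ _ (tpsi n)).
have idiff : leb.-integrable `[a, b] (EFin \o (fun x => `|psi n x - phi x|)).
  exact: (integrable_norm (integrableB _ ipsi iphi)).
have iddiff : leb.-integrable `[a, b]
    (EFin \o (fun x => `|(psi n)^`()%classic x - g x|)).
  exact: (integrable_norm (integrableB _ idpsi ig)).
have near_psi x : `[a, b]%classic x ->
    `|D x - psi n a| <= `|psi n x - phi x| + e'.
  move=> /=; rewrite in_itv/= => /andP[ax xb].
  have axab : `[a, x] `<=` `[a, b] by apply: subset_itvl; rewrite bnd_simp.
  (* The last bracket is the integral of psi' - g over [a, x], at most the L^1 norm of psi' - g over
     [a, b]. *)
  have -> : D x - psi n a = - (psi n x - phi x) + (psi n x - psi n a - G x).
    by rewrite /D; ring.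
  rewrite -(normrN (psi n x - phi x)); apply: le_trans (ler_normD _ _) _.
  rewrite lerD2l -(test_function_FTC _ _ (tpsi n) _ _ ax) /G.
  rewrite -RintegralB//; [|exact: integrableS idpsi|exact: integrableS ig].
  apply: le_trans.
    apply: le_normr_Rintegral => //.
    exact: integrableS (integrableB _ idpsi ig).
  rewrite -lee_fin; apply: le_trans (ltW H2).
  rewrite /Rintegral fineK; last first.
    by apply: integrable_fin_num => //; exact: integrableS iddiff.
  apply: ge0_subset_integral => //.
  exact: measurable_int iddiff.
apply: (@le_trans _ _ (\int[leb]_(x in `[a, b]) (`|psi n x - phi x| + e'))).
  apply: le_Rintegral => //.
  - exact: (integrable_norm (iDc _)).
  - exact: (integrableD _ idiff (icst _)).
rewrite RintegralD//; last exact: icst.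
rewrite Rintegral_cst// [leRHS](_ : e = e' + e' * (b - a)); last first.
  by rewrite -[X in X + _]mulr1 -mulrDr divfK// gt_eqF.
apply: lerD; last by rewrite /= lab.
rewrite -lee_fin /Rintegral fineK; first exact: ltW.
exact: integrable_fin_num.
Unshelve. all: by end_near. Qed.

End H10_primitive.

(** * Level sets of functions in H^1_0 *)

Section level_set.
Context {R : realType} (Omega : set R).

(** By Lebesgue differentiation the primitive has derivative [g] a.e.; the points of its level set
    with nonzero derivative are countable, hence null. *)
Lemma ae_level_primitive_eq0 (g : R -> R) (a b k : R) :
  leb.-integrable `[a, b] (EFin \o g) ->
  {ae leb, forall x, `[a, b]%classic x ->
     \int[leb]_(t in `[a, x]) g t = k -> g x = 0}.
Proof.
move=> ig.
(* Extended by zero, [g] is integrable on the line and its primitive can start at -oo, as in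
   [FTC1Ny]. *)
pose gab := g \_ `[a, b].
have igab : leb.-integrable setT (EFin \o gab).
  by rewrite -restrict_EFin; apply/integrable_restrict => //=; rewrite setTI.
pose F x := \int[leb]_(t in `]-oo, x]) gab t.
have F' : {ae leb, forall x, derivable F x 1 /\ (F^`())%classic x = gab x}.
  apply: FTC1Ny; first by move=> y; exact: integrableS igab.
  exact: integrable_locally.
have isolated : {ae leb, forall x, ~ [set x | [/\ F x = k, derivable F x 1 &
    (F^`())%classic x != 0]] x}.
  have cS := countable_level_derive_neq0 F k.
  exists [set x | [/\ F x = k, derivable F x 1 & (F^`())%classic x != 0]].
  split; [exact: countable_measurable|exact: countable_lebesgue_measure0|].
  by move=> x /contrapT.
apply: filterS2 F' isolated => x [dF F'x] Nx xab Gx; apply: contrapT => /eqP gx.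
apply: Nx; split => //; last by rewrite F'x /gab patchE mem_set.
(* For x in [a, b] both primitives integrate the same function, since [gab] vanishes to the left of
   [a]. *)
rewrite -Gx /F Rintegral_mkcond [RHS]Rintegral_mkcond; congr Rintegral.
apply/funext => t; rewrite !patchE.
move: xab; rewrite /= in_itv/= => /andP[ax xb].
have [tx|xt] := leP t x; last first.
  by rewrite !memNset; [|rewrite /= in_itv/= [t <= x]leNgt xt andbF|
    rewrite /= in_itv/= leNgt xt].
rewrite mem_set; last by rewrite /= in_itv.
have [at_|ta] := leP a t.
  rewrite mem_set; last by rewrite /= in_itv/= at_ tx.
  by rewrite /gab patchE mem_set// /= in_itv/= at_ (le_trans tx).
rewrite [in RHS]memNset; last by rewrite /= in_itv/= [a <= t]leNgt ta.
by rewrite /gab patchE memNset// /= in_itv/= [a <= t]leNgt ta.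
Qed.

Lemma ae_H10_level_eq0 (phi g : R -> R) (k : R) : open Omega ->
  H10 Omega phi g -> {ae leb, forall x, Omega x -> phi x = k -> g x = 0}.
Proof.
move=> oO H.
have mO : measurable Omega by exact: open_measurable.
have loc (a b : R) : {ae leb, forall x, a < b -> `[a, b] `<=` Omega ->
    `[a, b]%classic x -> phi x = k -> g x = 0}.
  have [ab|?] := pselect (a < b /\ `[a, b] `<=` Omega); last first.
    by apply: aeW => x ab abO; exfalso; tauto.
  case: ab => ab abO.
  have [C phiC] := H10_ae_primitive _ _ _ _ _ mO H ab abO.
  have ig : leb.-integrable `[a, b] (EFin \o g).
    by case: H => -[_ gL _] _; exact: Lp2_integrable_itv abO gL.
  (* As phi = C + primitive a.e. on [a, b], the level k of [phi] is the level k - C of the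
     primitive. *)
  have := ae_level_primitive_eq0 _ _ _ (k - C) ig.
  apply: filterS2 phiC => x phix Gx _ _ xab phik; apply: Gx => //.
  by rewrite -phik phix// addrC addKr.
(* Rational intervals suffice to cover [Omega]. They are coded by naturals through [unpickle], so
   that [ae_foralln] combines the countably many exceptional sets. *)
have : {ae leb, forall x, forall n, forall p q : rat,
    unpickle n = Some (p, q) -> (ratr p < ratr q :> R) ->
    `[ratr p, ratr q] `<=` Omega ->
    `[ratr p, ratr q]%classic x -> phi x = k -> g x = 0}.
  apply/ae_foralln => n; case: (@unpickle (rat * rat)%type n) => [[p q]|].
    by apply: filterS (loc (ratr p) (ratr q)) => x Hx p' q' [<- <-].
  by apply: aeW.
apply: filterS => x Hx Ox phik.
have : nbhs x Omega by exact: open_nbhs_nbhs.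
rewrite -nbhs_ballE => -[e /= e0 eO].
have [p pP] : exists p : rat, ratr p \in `]x - e, x[.
  by apply: rat_in_itvoo; rewrite ltrBlDr ltrDl.
have [q qP] : exists q : rat, ratr q \in `]x, x + e[.
  by apply: rat_in_itvoo; rewrite ltrDl.
move: pP qP; rewrite !in_itv/= => /andP[p1 p2] /andP[q1 q2].
apply: (Hx (pickle (p, q)) p q) => //; first exact: pickleK.
- exact: lt_trans p2 q1.
- move=> y /=; rewrite in_itv/= => /andP[py yq]; apply: eO.
  by rewrite /ball/= ltr_distlC (lt_le_trans p1 py) (le_lt_trans yq q2).
- by rewrite /= in_itv/= (ltW p2) (ltW q1).
Qed.

End level_set.

(** * Equality case of the Hoelder inequality between L^1 and L^oo *)

Lemma ae_extremal_of_Rintegral_eq {d} {T : measurableType d} {R : realType}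
    (mu : {measure set T -> \bar R}) (B : set T) (phi w : T -> R) (M beta : R) :
  measurable B -> mu.-integrable B (EFin \o phi) -> measurable_fun B w ->
  0 <= M -> {ae mu, forall x, B x -> `|w x| <= M} ->
  \int[mu]_(x in B) `|phi x| <= beta ->
  \int[mu]_(x in B) (phi x * w x) = beta * M ->
  {ae mu, forall x, B x -> phi x != 0 -> `|w x| = M}.
Proof.
move=> mB iphi mw M0 wM phib phiw.
have mphi : measurable_fun B phi.
  exact/measurable_EFinP/(measurable_int _ iphi).
have iM : mu.-integrable B (EFin \o (fun x => M * `|phi x|)).
  exact: (integrableZl _ M (integrable_norm iphi)).
have mphiw : measurable_fun B (fun x => phi x * w x) by exact: measurable_funM.
(* Domination by M |phi|, valid a.e. *)
have iphiw : mu.-integrable B (EFin \o (fun x => phi x * w x)).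
  apply/integrableP; split; first exact/measurable_EFinP.
  have /integrableP[mM] := iM; apply: le_lt_trans.
  apply: ae_ge0_le_integral => //.
  - exact/measurableT_comp/measurable_EFinP.
  - exact/measurableT_comp.
  - apply: filterS wM => x /= wM Bx; rewrite lee_fin normrM.
    by rewrite [leRHS]ger0_norm ?mulr_ge0// mulrC ler_wpM2r// wM.
pose h x := M * `|phi x| - phi x * w x.
have ih : mu.-integrable B (EFin \o h) by exact: (integrableB _ iM iphiw).
have h0 : {ae mu, forall x, B x -> 0 <= h x}.
  apply: filterS wM => x wM Bx; rewrite subr_ge0 (le_trans (ler_norm _))//.
  by rewrite normrM mulrC ler_wpM2r// wM.
have inth : \int[mu]_(x in B) h x <= 0.
  rewrite RintegralB// RintegralZl//; last exact: integrable_norm.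
  by rewrite phiw subr_le0 mulrC ler_wpM2r.
have normh : (\int[mu]_(x in B) `|(EFin \o h) x| = 0)%E.
  (* [h] is nonnegative only a.e., so the integral of |h| is identified with that of [h] through
     [ae_eq]. *)
  have hn : ae_eq mu B (abse \o (EFin \o h)) (EFin \o h).
    by apply: filterS h0 => x /[apply] h0; rewrite /= ger0_norm.
  apply/eqP; rewrite eq_le integral_ge0 ?andbT//.
  have mh := measurable_int _ ih.
  rewrite (ae_eq_integral (EFin \o h) _ mB _ mh hn);
    last exact: measurableT_comp.
  by rewrite -[leLHS]fineK ?lee_fin//; exact: integrable_fin_num.
move/ae_eq_integral_abs : normh => /(_ mB (measurable_int _ ih)) hE.
(* Where h = 0, |phi| |w| = |phi w| = M |phi|, and |phi| > 0 cancels. *)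
apply: filterS2 hE wM => x hE wM Bx phi0; apply/eqP; rewrite eq_le wM//=.
have /eqP := hE Bx; rewrite eqe subr_eq0 => /eqP hx.
have phi_gt0 : 0 < `|phi x| by rewrite normr_gt0.
rewrite -(ler_pM2l phi_gt0) -normrM -hx mulrC [leRHS]ger0_norm ?lexx//.
by rewrite mulr_ge0.
Qed.

(** * The L^oo norm as an essential supremum *)

Section Linfty.
Context {R : realType} (Omega : set R).

(** The norm of exponent +oo is an essential supremum only when the whole space has positive
    measure. *)
Lemma lebesgue_measure_setT_gt0 : (0 < (@lebesgue_measure R) [set: R])%E.
Proof.
by rewrite -set_itvNyy lebesgue_measure_itv /= ltry.
Qed.

Lemma LpNormyE (w : R -> R) :
  LpNorm Omega +oo%E w = ess_sup leb (abse \o (EFin \o (w \_ Omega))).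
Proof. by rewrite /LpNorm unlock; rewrite lebesgue_measure_setT_gt0. Qed.

Lemma ae_le_LpNormy (w : R -> R) :
  {ae leb, forall x, Omega x -> ((`|w x|)%:E <= LpNorm Omega +oo%E w)%E}.
Proof.
rewrite LpNormyE.
have : {ae leb, forall x, ((abse \o (EFin \o (w \_ Omega))) x
    <= ess_sup leb (abse \o (EFin \o (w \_ Omega))))%E} by exact: ess_sup_ge.
by apply: filterS => x + Ox; rewrite /= patchE mem_set.
Qed.

Lemma LpNormy_ae0 (w : R -> R) : {ae leb, forall x, Omega x -> w x = 0} ->
  LpNorm Omega +oo%E w = 0%E.
Proof.
move=> w0; rewrite LpNormyE; apply: ess_sup_ae_cst.
  exact: lebesgue_measure_setT_gt0.
have : {ae leb, forall x, (abse \o (EFin \o (w \_ Omega))) x = 0%E}.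
  apply: filterS w0 => x w0 /=; rewrite patchE.
  by case: ifPn => [/set_mem/w0 ->|_]; rewrite normr0.
exact.
Qed.

Lemma LpNorm1E (phi : R -> R) :
  LpNorm Omega 1%E phi = (\int[leb]_(x in Omega) (`|phi x|)%:E)%E.
Proof.
rewrite /LpNorm Lnorm1 [RHS]integral_mkcond; apply: eq_integral => x _ /=.
by rewrite !patchE; case: ifPn => //; rewrite normr0.
Qed.

End Linfty.

(** * Consequences of the optimality conditions *)

Section dual.
Context {R : realType} (Omega : set R) (alpha beta : R) (f u w phi : R -> R).
Hypothesis oOmega : open Omega.
Hypothesis alpha_gt0 : 0 < alpha.
Hypothesis dual : dual_function Omega alpha beta f u w phi.

Let mOmega : measurable Omega. Proof. exact: open_measurable. Qed.

Lemma dual_ae_norm_eq : Lp Omega +oo%E w ->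
  {ae leb, forall x, Omega x -> phi x != 0 ->
     (`|w x|)%:E = LpNorm Omega +oo%E w}.
Proof.
move=> wL; have [_ [[phiL _ _] _] _ [phib phiw]] := dual.
(* For [w] zero a.e., the optimality conditions give no equation for the integral of phi w; both
   sides of the claim are then 0. *)
have [w0|w0] := pselect {ae leb, forall x, Omega x -> w x = 0}.
  rewrite LpNormy_ae0//; apply: filterS w0 => x w0 Ox _.
  by rewrite w0// normr0.
have wfin : LpNorm Omega +oo%E w \is a fin_num.
  by rewrite ge0_fin_numE ?Lnorm_ge0//; move: wL; rewrite /Lp inE => /andP[_];
    rewrite inE.
have wle := ae_le_LpNormy Omega w.
have wM : {ae leb, forall x, Omega x -> `|w x| <= fine (LpNorm Omega +oo%E w)}.
  by apply: filterS wle => x wle Ox; rewrite -lee_fin fineK// wle.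
have mphi : measurable_fun Omega phi.
  by apply: (measurable_fun_patch_sub Omega) => //; exact: Lp_measurable phiL.
have mw : measurable_fun Omega w.
  by apply: (measurable_fun_patch_sub Omega) => //;
    exact: (Lp_measurable _ _ _ wL).
(* [phi] comes in L^2 and [Omega] may be unbounded; integrability follows from the L^1 bound by
   [beta]. *)
have iphi : leb.-integrable Omega (EFin \o phi).
  apply/integrableP; split; first exact/measurable_EFinP.
  by apply: le_lt_trans (ltry beta); rewrite -LpNorm1E.
have H : {ae leb, forall x, Omega x -> phi x != 0 ->
    `|w x| = fine (LpNorm Omega +oo%E w)}.
  apply: (@ae_extremal_of_Rintegral_eq _ _ _ leb Omega phi w _ beta) => //.
  - by rewrite fine_ge0// Lnorm_ge0.
  - rewrite -lee_fin /Rintegral fineK -?LpNorm1E//.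
    by rewrite ge0_fin_numE ?Lnorm_ge0// (le_lt_trans phib)// ltry.
  - by rewrite /Rintegral phiw// -[X in (_ * X)%E](fineK wfin).
by apply: filterS H => x H Ox phi0; rewrite H// fineK.
Qed.

Lemma dual_ae_density_eq (u' : R -> R) :
  ac_density Omega (distributional_derivative Omega u) u' ->
  {ae leb, forall x, Omega x -> `|phi x| != alpha -> u' x = w x}.
Proof.
move=> [iu' [mus [N [mN N0 musN]] muE]].
have [_ [[phiL _ _] _] [hw [psi Spsi psiE]] _] := dual.
(* Off the null set [N] the singular part vanishes, so on subsets of [E] the measure Du is the
   integral of [u']; by [Sgn_null], applied to psi = phi / alpha, it is also the integral of [w]. *)
pose E := [set x | Omega x /\ `|phi x| != alpha] `\` N.
have mE : measurable E.
  apply: measurableD => //.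
  rewrite (_ : [set x | _] = Omega `&` (fun x => `|phi x|) @^-1` [set~ alpha]);
    last first.
    by apply/seteqP; split=> x [Ox /eqP].
  apply: measurableT_comp => //; last exact: measurableC.
  by apply: (measurable_fun_patch_sub Omega) => //; exact: Lp_measurable phiL.
have EO : E `<=` Omega by move=> x [[]].
have uw : ae_eq leb E (EFin \o u') (EFin \o (w \_ Omega)).
  apply: integral_ae_eq => //.
  - exact: integrableS iu'.
  - exact: measurable_funTS (measurable_int _ hw).
  move=> A AE mA.
  have Apsi x : A x -> `|psi x| != 1.
    move=> /AE[[_ +] _]; apply: contra_neq => psi1.
    by rewrite -psiE normrM gtr0_norm// psi1 mulr1.
  have : (distributional_derivative Omega u A
      - \int[leb]_(x in A) ((w \_ Omega) x)%:E = 0)%E.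
    exact: Sgn_null Spsi mA (subset_trans AE EO) Apsi.
  rewrite muE//; last exact: subset_trans EO.
  rewrite musN//; last by rewrite -subset0 => x [/AE[]].
  rewrite adde0 => /eqP; rewrite sube_eq ?add0e; last 2 first.
  - by apply: integrable_fin_num => //; apply: integrableS iu' => //;
      exact: subset_trans EO.
  - exact: fin_num_adde_defr.
  by move=> /eqP.
have N0' : {ae leb, forall x, ~ N x} by exists N; split => // x /contrapT.
apply: filterS2 uw N0' => x uw Nx Ox phix.
by have := uw (conj (conj Ox phix) Nx); rewrite /= patchE mem_set// => -[].
Qed.

End dual.

Theorem proposition3 (R : realType) (Omega : set R) (alpha beta : R)
    (f u w phi : R -> R) :
  open_interval Omega ->
  0 < alpha -> 0 < beta ->
  Lp Omega 2%:E f ->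
  is_solution Omega alpha beta f u w ->
  dual_function Omega alpha beta f u w phi ->
  {ae @lebesgue_measure R, forall x, Omega x -> phi x != 0 ->
     (`|w x|)%:E = LpNorm Omega +oo%E w} /\
  (forall u' : R -> R,
     ac_density Omega (distributional_derivative Omega u) u' ->
     {ae @lebesgue_measure R, forall x, Omega x ->
        u x > f x \/ u x < f x ->
        (`|u' x|)%:E = LpNorm Omega +oo%E w}).
Proof.
move=> [_ oO _] alpha0 _ _ [_ wL _] dual.
have wE := dual_ae_norm_eq _ _ _ _ _ _ _ oO dual wL.
split=> // u' u'E.
have uw := dual_ae_density_eq _ _ _ _ _ _ _ oO alpha0 dual _ u'E.
have [_ H _ _] := dual.
have level k := ae_H10_level_eq0 _ _ _ k oO H.
(* Almost every point with u <> f avoids three levels of [phi]: 0, so that |w| is the norm of [w],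
   and alpha and - alpha, so that u' = w. *)
apply: filterS3 (filterI (level 0) (level alpha))
  (filterI (level (- alpha)) wE) uw.
move=> x [phi0 phia] [phiNa wx] uw Ox uf.
have g0 : (u \- f) x != 0 by rewrite /= subr_eq0;
  case: uf => [/gt_eqF ->|/lt_eqF ->].
rewrite uw// ?wx//.
- by apply: contra_neq g0; exact: phi0.
- apply/negP; rewrite eqr_norml => /andP[/orP[]/eqP phiE _].
    by move/eqP: g0; apply; exact: phia.
  by move/eqP: g0; apply; exact: phiNa.
Qed.
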